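(* Let $d\geq2$. For configurations $x=(x_1,\dots,x_{d+2})$ of the symmetric form described in the context, the only two nontrivial Laura-Andoyer equations are $L_{1324}=0$ and $L_{2314}=0$. That is: for all pairwise distinct $i,j,l_1,l_2\in\{1,\dots,d+2\}$ with $i<j$ and $l_1<l_2$, either $L_{ijl_1l_2}=0$ for all configurations of this form (for all values of $a,s,k$), or $L_{ijl_1l_2}=L_{1324}$ for all of them, or $L_{ijl_1l_2}=L_{2314}$ for all of them; and neither $L_{1324}$ nor $L_{2314}$ vanishes identically on all configurations of this form (with $a,s,k$ varying). Here $$L_{1324}=m_2(R_{12}-R_{23})\triangle_4-m_4(R_{14}-R_{34})\triangle_2,\qquad L_{2314}=m_1(R_{12}-R_{13})\triangle_4-m_4(R_{24}-R_{34})\triangle_1.$$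
   Context: Configurations considered: $d+2$ bodies in $\mathbb R^d$, where $x_3,\dots,x_{d+2}$ have masses $m_3=\dots=m_{d+2}=1$ and are the vertices of a regular $(d-1)$-dimensional simplex of unit edge length, and $x_1,x_2$, with nonzero real masses $m_1=s$, $m_2=k$, are at distinct positions on the line through the center of the simplex orthogonal to it. For $a\in\mathbb R$ put $R_{ij}=\|x_i-x_j\|^{2a}$. For pairwise distinct $i,j,l_1,l_2$, $$L_{ijl_1l_2}=m_{l_1}(R_{il_1}-R_{jl_1})\triangle_{l_2}-m_{l_2}(R_{il_2}-R_{jl_2})\triangle_{l_1},$$ where $\triangle_l=(-1)^{l+1}\det X_l$ and $X_l$ is the $(d+1)\times(d+1)$ matrix with columns $\binom{1}{x_p}$, $p\neq l$, in increasing order of $p$. The Laura-Andoyer equations are $L_{ijl_1l_2}=0$ for all pairwise distinct $i,j,l_1,l_2$ with $i<j$, $l_1<l_2$. *)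

(* Defs.v *)
From HB Require Import structures.
From mathcomp Require Import all_boot all_order all_algebra.
From mathcomp Require Import reals exp.
Set Implicit Arguments.
Unset Strict Implicit.
Unset Printing Implicit Defensive.
Import Order.TTheory GRing.Theory Num.Theory.
Local Open Scope ring_scope.

(* MathComp's norm on matrices is the sup norm, hence these Euclidean
   definitions. *)
Definition dotv (R : realType) (d : nat) (u v : 'cV[R]_d) : R :=
  \sum_(c < d) u c 0 * v c 0.

Definition edist (R : realType) (d : nat) (u v : 'cV[R]_d) : R :=
  Num.sqrt (dotv (u - v) (u - v)).

Definition affinely_independent (R : realType) (d n : nat)
    (v : 'I_n -> 'cV[R]_d) : Prop :=
  forall c : 'I_n -> R,
    \sum_(q < n) c q = 0 -> \sum_(q < n) c q *: v q = 0 -> forall q, c q = 0.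

Definition unit_regular_simplex (R : realType) (d n : nat)
    (v : 'I_n -> 'cV[R]_d) : Prop :=
  affinely_independent v /\ forall p q, p != q -> edist (v p) (v q) = 1.

Definition barycenter (R : realType) (d n : nat) (v : 'I_n -> 'cV[R]_d) :
    'cV[R]_d :=
  n%:R^-1 *: \sum_(q < n) v q.

(* The body with one-based label p, for 1 <= p <= d + 2; ordinals start at 0. *)
Definition body (d p : nat) : 'I_d.+2 := inord p.-1.
Arguments body {d} p.

(* The d bodies with labels 3, ..., d + 2. *)
Definition simplex_part (R : realType) (d : nat) (x : 'I_d.+2 -> 'cV[R]_d) :
    'I_d -> 'cV[R]_d :=
  fun q => x (rshift 2 q).

Definition symmetric_configuration (R : realType) (d : nat)
    (x : 'I_d.+2 -> 'cV[R]_d) : Prop :=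
  let v := simplex_part x in
  [/\ unit_regular_simplex v,
      exists2 u : 'cV[R]_d,
        u != 0 /\ (forall p q, dotv u (v p - v q) = 0)
        & exists t1 t2 : R,
            x (body 1) = barycenter v + t1 *: u /\
            x (body 2) = barycenter v + t2 *: u
    & x (body 1) <> x (body 2)].

Definition masses (R : realType) (d : nat) (s k : R) : 'I_d.+2 -> R :=
  fun i => if i == body 1 then s else if i == body 2 then k else 1.

Definition Rdist (R : realType) (d : nat) (a : R) (x : 'I_d.+2 -> 'cV[R]_d)
    (i j : 'I_d.+2) : R :=
  edist (x i) (x j) `^ (2 * a).

Definition augmented (R : realType) (d : nat) (x : 'I_d.+2 -> 'cV[R]_d) :
    'M[R]_(d.+1, d.+2) :=
  \matrix_(r < 1 + d, p < d.+2) col_mx (const_mx 1 : 'cV[R]_1) (x p) r 0.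

(* The one-based label of l is l.+1, so the sign exponent is l.+1 + 1. *)
Definition triangle (R : realType) (d : nat) (x : 'I_d.+2 -> 'cV[R]_d)
    (l : 'I_d.+2) : R :=
  (-1) ^+ (l.+1 + 1) * \det (col' l (augmented x) : 'M[R]_d.+1).

Definition laura_andoyer (R : realType) (d : nat) (a : R) (m : 'I_d.+2 -> R)
    (x : 'I_d.+2 -> 'cV[R]_d) (i j l1 l2 : 'I_d.+2) : R :=
  m l1 * (Rdist a x i l1 - Rdist a x j l1) * triangle x l2
  - m l2 * (Rdist a x i l2 - Rdist a x j l2) * triangle x l1.

Definition for_all_symmetric (R : realType) (d : nat)
    (P : R -> R -> R -> ('I_d.+2 -> 'cV[R]_d) -> Prop) : Prop :=
  forall (a s k : R) (x : 'I_d.+2 -> 'cV[R]_d),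
    s <> 0 -> k <> 0 -> symmetric_configuration x -> P a s k x.

(* Main.v *)
(* The signed minors [triangle x l] form an affine dependency of the bodies, and
   every such dependency [c] satisfies [c_1 t_1 + c_2 t_2 = 0], where [t_1] and
   [t_2] are the positions of the first two bodies on the axis, and is constant
   on the simplex.  Each axial body is moreover equidistant from all vertices,
   so an equation depends only on which of its indices are axial.  For the
   nonvanishing, put one axial body at the barycenter: the minor omitting the
   other axial body is then zero while those omitting a vertex are not, and the
   other axial body is closer to the barycenter than to a vertex. *)
Require Import Defs.
From mathcomp Require Import all_boot all_order all_algebra.
From mathcomp Require Import ring.
From mathcomp Require Import reals exp.
Set Implicit Arguments.
Unset Strict Implicit.
Unset Printing Implicit Defensive.
Import Order.TTheory GRing.Theory Num.Theory.
Local Open Scope ring_scope.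

(** * Bilinearity and positivity of the Euclidean inner product *)

Lemma dotvC (R : realType) (d : nat) (u v : 'cV[R]_d) : dotv u v = dotv v u.
Proof. by apply: eq_bigr => c _; rewrite mulrC. Qed.

Lemma dotvDl (R : realType) (d : nat) (u v w : 'cV[R]_d) :
  dotv (u + v) w = dotv u w + dotv v w.
Proof. by rewrite -big_split; apply: eq_bigr => c _; rewrite mxE mulrDl. Qed.

Lemma dotvZl (R : realType) (d : nat) (a : R) (u w : 'cV[R]_d) :
  dotv (a *: u) w = a * dotv u w.
Proof. by rewrite [RHS]mulr_sumr; apply: eq_bigr => c _; rewrite mxE mulrA. Qed.

Lemma dotvNl (R : realType) (d : nat) (u w : 'cV[R]_d) :
  dotv (- u) w = - dotv u w.
Proof. by rewrite -scaleN1r dotvZl mulN1r. Qed.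

Lemma dotv0l (R : realType) (d : nat) (w : 'cV[R]_d) : dotv 0 w = 0.
Proof. by rewrite -(scale0r 0) dotvZl mul0r. Qed.

Lemma dotvDr (R : realType) (d : nat) (u v w : 'cV[R]_d) :
  dotv w (u + v) = dotv w u + dotv w v.
Proof. by rewrite !(dotvC w) dotvDl. Qed.

Lemma dotvZr (R : realType) (d : nat) (a : R) (u w : 'cV[R]_d) :
  dotv w (a *: u) = a * dotv w u.
Proof. by rewrite !(dotvC w) dotvZl. Qed.

Lemma dotvNr (R : realType) (d : nat) (u w : 'cV[R]_d) :
  dotv w (- u) = - dotv w u.
Proof. by rewrite !(dotvC w) dotvNl. Qed.

Lemma dotv_sumr (R : realType) (d n : nat) (f : 'I_n -> 'cV[R]_d) (w : 'cV[R]_d) :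
  dotv w (\sum_i f i) = \sum_i dotv w (f i).
Proof.
apply: (big_morph (dotv w)) => [u v|]; first exact: dotvDr.
by rewrite dotvC dotv0l.
Qed.

Lemma dotv_ge0 (R : realType) (d : nat) (u : 'cV[R]_d) : 0 <= dotv u u.
Proof. by apply: sumr_ge0 => c _; rewrite -expr2 sqr_ge0. Qed.

Lemma dotv_gt0 (R : realType) (d : nat) (u : 'cV[R]_d) :
  u != 0 -> 0 < dotv u u.
Proof.
move=> u0; rewrite lt_neqAle dotv_ge0 andbT eq_sym.
apply: contra_neq u0 => /eqP; rewrite psumr_eq0; last first.
  by move=> c _; rewrite -expr2 sqr_ge0.
move=> /allP u0; apply/matrixP => c j; rewrite ord1 mxE.
by have := u0 c (mem_index_enum c); rewrite -expr2 sqrf_eq0 => /eqP.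
Qed.

Lemma edistC (R : realType) (d : nat) (u v : 'cV[R]_d) : edist u v = edist v u.
Proof. by rewrite /edist -opprB dotvNl dotvNr opprK. Qed.

Lemma edistxx (R : realType) (d : nat) (u : 'cV[R]_d) : edist u u = 0.
Proof. by rewrite /edist subrr dotv0l sqrtr0. Qed.

Lemma edist_sqr (R : realType) (d : nat) (u v : 'cV[R]_d) :
  edist u v ^+ 2 = dotv (u - v) (u - v).
Proof. by rewrite sqr_sqrtr ?dotv_ge0. Qed.

(* Expanding, along its first row, the determinant of [A] bordered above by a
   copy of its row [r] gives the left-hand side. *)
Lemma sum_signed_minors (R : comNzRingType) (m : nat) (A : 'M[R]_(m, m.+1))
    (r : 'I_m) : \sum_l A r l * ((-1) ^+ l * \det (col' l A)) = 0.
Proof.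
pose B : 'M_m.+1 := \matrix_(i, j) A (odflt r (unlift ord0 i)) j.
have detB : \det B = 0.
  apply: (@determinant_alternate _ _ B ord0 (lift ord0 r)) => // j.
  by rewrite !mxE unlift_none liftK.
apply: etrans detB; rewrite (expand_det_row B ord0); apply: eq_bigr => l _.
rewrite mxE unlift_none /cofactor add0n; congr (_ * (_ * \det _)).
by apply/matrixP => i j; rewrite !mxE liftK.
Qed.

(** * Indexing: two axial bodies followed by the vertices of the simplex *)

Lemma body1E (d : nat) : body 1 = @lshift 2 d ord0 :> 'I_d.+2.
Proof. by apply: val_inj; rewrite /= inordK. Qed.

Lemma body2E (d : nat) : body 2 = @lshift 2 d ord_max :> 'I_d.+2.
Proof. by apply: val_inj; rewrite /= inordK. Qed.

Lemma body_rshift (d : nat) (p : nat) (hp : (p < d)%N) :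
  body p.+3 = rshift 2 (Ordinal hp) :> 'I_d.+2.
Proof. by apply: val_inj; rewrite /= inordK // !ltnS. Qed.

Lemma simplex_body_eq (d : nat) (p q : 'I_d) :
  (rshift 2 p == rshift 2 q :> 'I_d.+2) = (p == q).
Proof. by rewrite -!val_eqE /= eqn_add2l. Qed.

(** The view keeps [body 1] and [body 2] folded, so that a case analysis lands directly on the forms
    used in the statements about axial bodies. *)
Variant body_spec (d : nat) : 'I_d.+2 -> Type :=
| BodyFirst : body_spec (body 1)
| BodySecond : body_spec (body 2)
| BodySimplex (q : 'I_d) : body_spec (rshift 2 q).

Lemma bodyP (d : nat) (i : 'I_d.+2) : body_spec i.
Proof.
case: (@split_ordP 2 d i) => [[[|[|//]] hp]|q] ->; last exact: BodySimplex.
  have -> : @lshift 2 d (Ordinal hp) = body 1; last exact: BodyFirst.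
  by rewrite body1E; congr lshift; apply: val_inj.
have -> : @lshift 2 d (Ordinal hp) = body 2; last exact: BodySecond.
by rewrite body2E; congr lshift; apply: val_inj.
Qed.

Lemma sum_bodies (V : nmodType) (d : nat) (F : 'I_d.+2 -> V) :
  \sum_i F i = F (body 1) + F (body 2) + \sum_(q < d) F (rshift 2 q).
Proof.
rewrite (@big_split_ord _ _ _ 2 d) /= big_ord_recl big_ord1 body1E body2E.
by congr (_ + F _ + _); apply: val_inj.
Qed.

(** * Affine dependencies of the bodies *)

(** The signed minors annihilate every row of the augmented matrix: the row of ones gives the first
    equation, the coordinate rows the second. *)
Lemma triangle_dependency (R : realType) (d : nat) (x : 'I_d.+2 -> 'cV[R]_d) :
  \sum_l triangle x l = 0 /\ \sum_l triangle x l *: x l = 0.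
Proof.
have E r : \sum_l augmented x r l * triangle x l = 0.
  apply: etrans (sum_signed_minors (augmented x) r); apply: eq_bigr => l _.
  (* The exponent in [triangle] is [l + 2], so the two extra signs cancel. *)
  by rewrite /triangle addn1 !exprS !mulN1r opprK.
split.
  apply: etrans (E (@lshift 1 d ord0)); apply: eq_bigr => l _.
  by rewrite mxE col_mxEu mxE mul1r.
apply/matrixP => r j; rewrite ord1 summxE mxE.
apply: etrans (E (@rshift 1 d r)); apply: eq_bigr => l _.
by rewrite mxE [augmented _ _ _]mxE col_mxEd mulrC.
Qed.

(** A nonzero kernel vector of the singular minor, extended by zero at the omitted body. The
    transpose is taken because [det0P] yields a left kernel vector. *)
Lemma triangle_eq0_dependency (R : realType) (d : nat) (x : 'I_d.+2 -> 'cV[R]_d)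
    (l : 'I_d.+2) : triangle x l = 0 ->
  exists c : 'I_d.+2 -> R,
    [/\ c l = 0, exists p, c p != 0, \sum_p c p = 0 & \sum_p c p *: x p = 0].
Proof.
move/eqP; rewrite mulf_eq0 signr_eq0 /= -det_tr => /det0P[w w0 wA].
pose c p := if unlift l p is Some q then w 0 q else 0.
have cl : c l = 0 by rewrite /c unlift_none.
have ce q : c (lift l q) = w 0 q by rewrite /c liftK.
have E r : \sum_p augmented x r p * c p = 0.
  rewrite (bigD1_ord l) //= cl mulr0 add0r.
  move/matrixP/(_ 0 r): wA; rewrite !mxE => wA; apply: etrans wA.
  by apply: eq_bigr => q _; rewrite ce !mxE mulrC.
exists c; split=> //.
- have [q wq] : exists q, w 0 q != 0.
    apply/existsP; apply: contraNT w0 => /existsPn w0; apply/eqP/rowP => q.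
    by rewrite mxE; apply/eqP/negbNE/w0.
  by exists (lift l q); rewrite ce.
- apply: etrans (E (@lshift 1 d ord0)); apply: eq_bigr => p _.
  by rewrite mxE col_mxEu mxE mul1r.
apply/matrixP => r j; rewrite ord1 summxE mxE.
apply: etrans (E (@rshift 1 d r)); apply: eq_bigr => p _.
by rewrite mxE [augmented _ _ _]mxE col_mxEd mulrC.
Qed.

Lemma dotv_barycenter (R : realType) (d n : nat) (v : 'I_n -> 'cV[R]_d)
    (u : 'cV[R]_d) (q : 'I_n) :
  (forall p r, dotv u (v p - v r) = 0) -> dotv u (barycenter v) = dotv u (v q).
Proof.
move=> huv; have n0 : n%:R != 0 :> R.
  by rewrite pnatr_eq0 -lt0n (leq_trans _ (ltn_ord q)).
rewrite dotvZr dotv_sumr (eq_bigr (fun=> dotv u (v q))) => [|p _].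
  by rewrite sumr_const card_ord -[X in _ * X]mulr_natl mulKf.
by apply/eqP; rewrite -subr_eq0 -dotvNr -dotvDr huv.
Qed.

(** Pairing the dependency with [u] isolates the axial positions. Once the axial terms along [u]
    have cancelled, the axial bodies contribute [c_1 + c_2] times the barycenter; spreading this
    evenly over the vertices leaves a dependency of the simplex, which is trivial. *)
Lemma symmetric_dependency (R : realType) (d : nat) (x : 'I_d.+2 -> 'cV[R]_d)
    (u : 'cV[R]_d) (t1 t2 : R) (c : 'I_d.+2 -> R) :
    let v := simplex_part x in
    affinely_independent v -> u != 0 -> (forall p q, dotv u (v p - v q) = 0) ->
    x (body 1) = barycenter v + t1 *: u -> x (body 2) = barycenter v + t2 *: u ->
    \sum_p c p = 0 -> \sum_p c p *: x p = 0 ->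
  c (body 1) * t1 + c (body 2) * t2 = 0 /\
  forall q, c (rshift 2 q) = - (c (body 1) + c (body 2)) / d%:R.
Proof.
move=> v hv u0 huv x1 x2; rewrite !sum_bodies x1 x2.
have ub q : dotv u (x (rshift 2 q)) = dotv u (barycenter v).
  exact/esym/(dotv_barycenter q huv).
have bE : barycenter v = d%:R^-1 *: \sum_q v q by [].
move: (barycenter v) ub bE => b ub bE.
set c1 := c (body 1); set c2 := c (body 2) => s0 sx.
have ct : c1 * t1 + c2 * t2 = 0.
  have /eqP := congr1 (dotv u) sx.
  rewrite !dotvDr !dotvZr !dotvDr !dotvZr dotv_sumr [X in _ == X]dotvC dotv0l.
  rewrite (eq_bigr (fun q => c (rshift 2 q) * dotv u b)) => [|q _]; last first.
    by rewrite dotvZr ub.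
  rewrite -mulr_suml.
  (* All vertices have the same product with [u] as the barycenter, so only their total weight
     enters. *)
  have -> : \sum_(q < d) c (rshift 2 q) = - (c1 + c2).
    by apply/eqP; rewrite -addr_eq0 addrC s0.
  have -> : c1 * (dotv u b + t1 * dotv u u) + c2 * (dotv u b + t2 * dotv u u)
     + - (c1 + c2) * dotv u b = (c1 * t1 + c2 * t2) * dotv u u by ring.
  by rewrite mulf_eq0 (gt_eqF (dotv_gt0 u0)) orbF => /eqP.
split=> // q.
have d0 : d%:R != 0 :> R by rewrite pnatr_eq0 -lt0n (leq_trans _ (ltn_ord q)).
apply/eqP; rewrite mulNr -addr_eq0; apply/eqP.
(* Each vertex receives its own weight plus its share of the barycenter's weight [c1 + c2]. *)
apply: (hv (fun q => c (rshift 2 q) + (c1 + c2) / d%:R)).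
  rewrite big_split /= sumr_const card_ord -[X in _ + X]mulr_natr divfK //.
  by rewrite addrC.
under eq_bigr do rewrite scalerDl.
rewrite big_split /= -scaler_sumr -scalerA -bE.
apply: etrans sx.
rewrite !scalerDr !scalerA addrACA -scalerDl -[_ *: u + _ *: u]scalerDl ct.
by rewrite scale0r addr0 addrC.
Qed.

(** * Symmetries of the distances, minors and masses *)

(** The difference [f] of the squared distances to two vertices is affine and sums to zero over the
    vertices, hence vanishes at the barycenter; moving along [u] does not change it, since [u] is
    orthogonal to the edge [w]. *)
Lemma regular_equidistant (R : realType) (d n : nat) (v : 'I_n -> 'cV[R]_d)
    (u : 'cV[R]_d) (t : R) (p q : 'I_n) :
    unit_regular_simplex v -> (forall p q, dotv u (v p - v q) = 0) ->
  edist (barycenter v + t *: u) (v p) = edist (barycenter v + t *: u) (v q).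
Proof.
move=> [_ hv] huv.
(* [f y] is an affine function of [y] with linear part [dotv _ w]. *)
pose w := v q - v p.
pose f y := dotv (y - v p) (y - v p) - dotv (y - v q) (y - v q).
have fE y : f y = 2 * dotv w y + dotv (v p) (v p) - dotv (v q) (v q).
  rewrite /f /w !(dotvDl, dotvDr, dotvNl, dotvNr).
  by rewrite (dotvC y (v p)) (dotvC y (v q)); ring.
have sum_f : \sum_r f (v r) = 0.
  under eq_bigr do rewrite /f -!edist_sqr.
  (* From any vertex, the other [n - 1] vertices are at distance one, so the sum does not depend on
     the vertex. *)
  have D s : \sum_r edist (v r) (v s) ^+ 2 = n%:R - 1.
    rewrite (bigD1 s) //= edistxx expr0n add0r.
    under eq_bigr => r rs do rewrite hv // expr1n.
    by rewrite sumr_const cardC1 card_ord -subn1 natrB // (leq_trans _ (ltn_ord s)).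
  by rewrite sumrB !D subrr.
have n0 : n%:R != 0 :> R by rewrite pnatr_eq0 -lt0n (leq_trans _ (ltn_ord p)).
have fb : f (barycenter v + t *: u) = 0.
  apply: (mulfI n0); rewrite mulr0; apply: etrans sum_f.
  under [RHS]eq_bigr do rewrite fE.
  rewrite !fE dotvDr !dotvZr dotv_sumr (dotvC w u) huv.
  rewrite sumrB big_split /= -mulr_sumr !sumr_const card_ord.
  rewrite -[X in _ = _ + X - _]mulr_natl -[X in _ = _ - X]mulr_natl.
  by field.
by rewrite /edist; congr Num.sqrt; apply/eqP; rewrite -subr_eq0 -/(f _) fb.
Qed.

Lemma RdistC (R : realType) (d : nat) (a : R) (x : 'I_d.+2 -> 'cV[R]_d) i j :
  Rdist a x i j = Rdist a x j i.
Proof. by rewrite /Rdist edistC. Qed.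

Lemma symmetric_Rdist (R : realType) (d : nat) (a : R) (x : 'I_d.+2 -> 'cV[R]_d) :
    symmetric_configuration x ->
  [/\ forall p q, Rdist a x (body 1) (rshift 2 p) = Rdist a x (body 1) (rshift 2 q),
      forall p q, Rdist a x (body 2) (rshift 2 p) = Rdist a x (body 2) (rshift 2 q)
    & forall p q, p != q -> Rdist a x (rshift 2 p) (rshift 2 q) = 1].
Proof.
move=> [hv [u [_ huv] [t1 [t2 [x1 x2]]]] _].
split=> p q.
- by rewrite /Rdist x1 (regular_equidistant t1 p q hv huv).
- by rewrite /Rdist x2 (regular_equidistant t2 p q hv huv).
by move=> pq; rewrite /Rdist (hv.2 p q pq) powR1.
Qed.

(** The signed minors are an affine dependency, and such dependencies are constant on the
    simplex. *)
Lemma symmetric_triangle (R : realType) (d : nat) (x : 'I_d.+2 -> 'cV[R]_d)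
    (p q : 'I_d) :
  symmetric_configuration x -> triangle x (rshift 2 p) = triangle x (rshift 2 q).
Proof.
move=> [[hv _] [u [u0 huv] [t1 [t2 [x1 x2]]]] _].
have [s0 sx] := triangle_dependency x.
have [_ E] := symmetric_dependency hv u0 huv x1 x2 s0 sx.
by rewrite !E.
Qed.

Lemma masses1 (R : realType) (d : nat) (s k : R) :
  masses s k (body 1 : 'I_d.+2) = s.
Proof. by rewrite /masses eqxx. Qed.

Lemma masses2 (R : realType) (d : nat) (s k : R) :
  masses s k (body 2 : 'I_d.+2) = k.
Proof. by rewrite /masses body1E body2E -val_eqE eqxx. Qed.

Lemma masses_simplex (R : realType) (d : nat) (s k : R) (q : 'I_d) :
  masses s k (rshift 2 q : 'I_d.+2) = 1.
Proof. by rewrite /masses body1E body2E -!val_eqE. Qed.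

(** * Classification of the equations by their axial indices *)

Lemma laura_andoyer_equal_Rdist (R : realType) (d : nat) (a : R)
    (m : 'I_d.+2 -> R) (x : 'I_d.+2 -> 'cV[R]_d) (i j l1 l2 : 'I_d.+2) :
    Rdist a x i l1 = Rdist a x j l1 -> Rdist a x i l2 = Rdist a x j l2 ->
  laura_andoyer a m x i j l1 l2 = 0.
Proof.
rewrite /laura_andoyer; move: (triangle x l1) (triangle x l2) => D1 D2 -> ->.
move: (Rdist a x j l1) (Rdist a x j l2) => r1 r2.
by rewrite !subrr !mulr0 !mul0r subrr.
Qed.

(** Two vertices are equally far from any third body, whether it is axial or another vertex, so both
    differences of [Rdist] vanish. *)
Lemma laura_andoyer_simplex_pair (R : realType) (d : nat) (a s k : R)
    (x : 'I_d.+2 -> 'cV[R]_d) (p q : 'I_d) (l1 l2 : 'I_d.+2) :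
    symmetric_configuration x -> p != q ->
    l1 \notin [:: rshift 2 p; rshift 2 q] -> l2 \notin [:: rshift 2 p; rshift 2 q] ->
  laura_andoyer a (masses s k) x (rshift 2 p) (rshift 2 q) l1 l2 = 0.
Proof.
move=> hx pq; have [E1 E2 E3] := symmetric_Rdist a hx.
have E l : l \notin [:: rshift 2 p; rshift 2 q : 'I_d.+2] ->
    Rdist a x (rshift 2 p) l = Rdist a x (rshift 2 q) l.
  case: (bodyP l) => [_|_|r].
  - by rewrite (RdistC _ _ (rshift 2 p)) (RdistC _ _ (rshift 2 q)); exact: E1.
  - by rewrite (RdistC _ _ (rshift 2 p)) (RdistC _ _ (rshift 2 q)); exact: E2.
  by rewrite !inE !negb_or !simplex_body_eq => /andP[rp rq]; rewrite !E3 // eq_sym.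
by move=> h1 h2; apply: laura_andoyer_equal_Rdist; apply: E.
Qed.

(** The two vertices have unit masses and equal minors, so the two terms of the equation coincide
    and cancel. *)
Lemma laura_andoyer_simplex_masses (R : realType) (d : nat) (a s k : R)
    (x : 'I_d.+2 -> 'cV[R]_d) (i j : 'I_d.+2) (p q : 'I_d) :
    symmetric_configuration x ->
    Rdist a x i (rshift 2 p) = Rdist a x i (rshift 2 q) ->
    Rdist a x j (rshift 2 p) = Rdist a x j (rshift 2 q) ->
  laura_andoyer a (masses s k) x i j (rshift 2 p) (rshift 2 q) = 0.
Proof.
move=> hx Ei Ej; rewrite /laura_andoyer !masses_simplex Ei Ej.
by rewrite (symmetric_triangle p q hx) subrr.
Qed.

(** Minors and distances from axial bodies are constant on the simplex and distinct vertices are at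
    distance one, so the choice of the two vertices does not matter. *)
Lemma laura_andoyer_pole_indep (R : realType) (d : nat) (a s k : R)
    (x : 'I_d.+2 -> 'cV[R]_d) (i l : 'I_d.+2) (p q p' q' : 'I_d) :
    i \in [:: body 1; body 2] -> l \in [:: body 1; body 2] ->
    symmetric_configuration x -> p != q -> p' != q' ->
  laura_andoyer a (masses s k) x i (rshift 2 p) l (rshift 2 q) =
  laura_andoyer a (masses s k) x i (rshift 2 p') l (rshift 2 q').
Proof.
move=> hi hl hx pq pq'; have [E1 E2 E3] := symmetric_Rdist a hx.
have E o r r' : o \in [:: body 1; body 2] ->
    Rdist a x o (rshift 2 r) = Rdist a x o (rshift 2 r').
  by rewrite !inE => /orP[]/eqP->.
rewrite /laura_andoyer !masses_simplex (symmetric_triangle q q' hx) (E i q q' hi).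
by rewrite ![Rdist a x (rshift 2 _) l]RdistC (E l p p' hl) !E3.
Qed.

Lemma laura_andoyer_trichotomy (R : realType) (d : nat) (p0 q0 : 'I_d)
    (i j l1 l2 : 'I_d.+2) :
    p0 != q0 -> uniq [:: i; j; l1; l2] -> (i < j)%N -> (l1 < l2)%N ->
    let L a s k x i j l1 l2 : R := laura_andoyer a (masses s k) x i j l1 l2 in
  [\/ for_all_symmetric (fun a s k x => L a s k x i j l1 l2 = 0),
      for_all_symmetric (fun a s k x => L a s k x i j l1 l2 =
        L a s k x (body 1) (rshift 2 p0) (body 2) (rshift 2 q0))
    | for_all_symmetric (fun a s k x => L a s k x i j l1 l2 =
        L a s k x (body 2) (rshift 2 p0) (body 1) (rshift 2 q0))].
Proof.
move=> pq0 hu ij ll L.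
have v1 : (body 1 : 'I_d.+2) = 0%N :> nat by rewrite (body1E d).
have v2 : (body 2 : 'I_d.+2) = 1%N :> nat by rewrite (body2E d).
move: hu ij ll; rewrite /= !inE !negb_or andbT.
case: (bodyP i) => [||p]; case: (bodyP j) => [||q];
  rewrite ?eqxx ?v1 ?v2 //=; last first.
(* Both [i] and [j] are vertices. *)
- rewrite simplex_body_eq => /andP[/and3P[pq pl1 pl2] /andP[/andP[ql1 ql2] _]] _ _.
  constructor 1 => a s k x _ _ hx.
  apply: laura_andoyer_simplex_pair => //.
    by rewrite !inE negb_or !(eq_sym l1) pl1.
  by rewrite !inE negb_or !(eq_sym l2) pl2.
(* Here [i] is [body 2] and [j] a vertex. The ordering of [l1] and [l2] leaves two cases: [l1] is
   [body 1] and [l2] a vertex, or both are vertices. *)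
- case: (bodyP l1) => [||p']; case: (bodyP l2) => [||q'];
    rewrite ?eqxx ?v1 ?v2 ?andbF //= !simplex_body_eq;
    move=> /and3P[_ /andP[h1 h2] h3] _ _.
    constructor 3 => a s k x _ _ hx.
    by apply: laura_andoyer_pole_indep => //; rewrite !inE eqxx ?orbT.
  constructor 1 => a s k x _ _ hx; have [E1 E2 E3] := symmetric_Rdist a hx.
  apply: (laura_andoyer_simplex_masses _ _ hx); first exact: E2.
  by rewrite !E3.
(* The same with [i] equal to [body 1]. *)
- case: (bodyP l1) => [||p']; case: (bodyP l2) => [||q'];
    rewrite ?eqxx ?v1 ?v2 ?andbF //= !simplex_body_eq;
    move=> /and3P[_ /andP[h1 h2] h3] _ _.
    constructor 2 => a s k x _ _ hx.
    by apply: laura_andoyer_pole_indep => //; rewrite !inE eqxx ?orbT.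
  constructor 1 => a s k x _ _ hx; have [E1 E2 E3] := symmetric_Rdist a hx.
  apply: (laura_andoyer_simplex_masses _ _ hx); first exact: E1.
  by rewrite !E3.
(* Both axial bodies are taken by [i] and [j], so [l1] and [l2] are vertices. *)
case: (bodyP l1) => [||p']; case: (bodyP l2) => [||q'];
  rewrite ?eqxx ?v1 ?v2 ?andbF //= => _ _ _.
constructor 1 => a s k x _ _ hx; have [E1 E2 E3] := symmetric_Rdist a hx.
by apply: (laura_andoyer_simplex_masses _ _ hx); [exact: E1|exact: E2].
Qed.

(** * Nonvanishing, by an explicit configuration with an axial body at the barycenter *)

(** Pythagoras: the displacement from a vertex is the axial displacement plus the orthogonal vector
    from the vertex to the barycenter, which is nonzero when there are at least two vertices. *)
Lemma edist_pole_simplex (R : realType) (d n : nat) (v : 'I_n -> 'cV[R]_d)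
    (u : 'cV[R]_d) (t : R) (q : 'I_n) :
    (1 < n)%N -> unit_regular_simplex v -> (forall p q, dotv u (v p - v q) = 0) ->
  edist (barycenter v) (barycenter v + t *: u) <
  edist (barycenter v + t *: u) (v q).
Proof.
move=> n1 hv huv; set b := barycenter v.
have bq : 0 < dotv (b - v q) (b - v q).
  apply: dotv_gt0; rewrite subr_eq0; apply/eqP => bvq.
  have [p pq] : exists p, p != q.
    apply/existsP; rewrite -negb_forall; apply/negP => /forallP allq.
    move: n1; rewrite ltnNge -[n]card_ord => /negP; apply.
    by rewrite -(card1 q); apply/subset_leq_card/subsetP => r _; apply: allq.
  (* A barycenter equal to one vertex would be at distance zero from all of them, against the unit
     edge length. *)
  have := regular_equidistant 0 q p hv huv.
  rewrite scale0r addr0 -/b bvq edistxx (hv.2 q p) 1?eq_sym // => /eqP.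
  by rewrite eq_sym oner_eq0.
have ubq : dotv u (b - v q) = 0.
  by rewrite dotvDr dotvNr (dotv_barycenter q huv) subrr.
have E : dotv (t *: u + (b - v q)) (t *: u + (b - v q)) =
    dotv (t *: u) (t *: u) + dotv (b - v q) (b - v q).
  move: (b - v q) ubq => w uw.
  by rewrite dotvDl !(dotvDr _ w) (dotvC w) (dotvZl t u w) uw mulr0 addr0 add0r.
rewrite edistC /edist.
have -> : b + t *: u - b = t *: u by rewrite addrC addKr.
have -> : b + t *: u - v q = t *: u + (b - v q) by rewrite addrAC addrC.
by rewrite E ltr_sqrt ?ltrDl // ltr_wpDl ?dotv_ge0.
Qed.

(** A vanishing minor gives a nontrivial dependency with weight zero at the omitted axial body. If
    the other axial body were off the barycenter, its weight would vanish too, and with it every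
    vertex weight. *)
Lemma triangle_pole_eq0 (R : realType) (d : nat) (x : 'I_d.+2 -> 'cV[R]_d)
    (u : 'cV[R]_d) (t1 t2 : R) :
    let v := simplex_part x in
    affinely_independent v -> u != 0 -> (forall p q, dotv u (v p - v q) = 0) ->
    x (body 1) = barycenter v + t1 *: u -> x (body 2) = barycenter v + t2 *: u ->
  (triangle x (body 1) = 0 -> t2 = 0) /\ (triangle x (body 2) = 0 -> t1 = 0).
Proof.
move=> v hv u0 huv x1 x2.
split=> /triangle_eq0_dependency[c [cl [p cp] s0 sx]];
  have [ct cE] := symmetric_dependency hv u0 huv x1 x2 s0 sx;
  apply/eqP; apply: contraNT cp => tn0; move: ct; rewrite cl.
  rewrite mul0r add0r => /eqP; rewrite mulf_eq0 (negbTE tn0) orbF => /eqP c2.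
  case: (bodyP p) => [||q]; rewrite ?cl ?c2 //.
  by rewrite cE cl c2 addr0 oppr0 mul0r.
rewrite mul0r addr0 => /eqP; rewrite mulf_eq0 (negbTE tn0) orbF => /eqP c1.
case: (bodyP p) => [||q]; rewrite ?c1 ?cl //.
by rewrite cE c1 cl addr0 oppr0 mul0r.
Qed.

(* The simplex has vertices [e_q / sqrt 2]; its axis is spanned by [(1, ..., 1)]. *)
Definition standard_simplex (R : realType) (d : nat) (q : 'I_d) : 'cV[R]_d :=
  (Num.sqrt 2)^-1 *: delta_mx q 0.

Definition standard_configuration (R : realType) (d : nat) (t1 t2 : R)
    (i : 'I_d.+2) : 'cV[R]_d :=
  match @split 2 d i with
  | inl h => barycenter (@standard_simplex R d)
             + (if h == ord0 then t1 else t2) *: const_mx 1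
  | inr q => standard_simplex R q
  end.

Lemma dotv_delta (R : realType) (d : nat) (p : 'I_d) (w : 'cV[R]_d) :
  dotv w (delta_mx p 0) = w p 0.
Proof.
rewrite /dotv (bigD1 p) //= mxE !eqxx mulr1 big1 ?addr0 // => c cp.
by rewrite mxE (negbTE cp) mulr0.
Qed.

(** Distinct basis vectors are at distance [sqrt 2], which the scaling brings to one. *)
Lemma standard_simplex_regular (R : realType) (d : nat) :
  unit_regular_simplex (@standard_simplex R d).
Proof.
have s2 : Num.sqrt 2 != 0 :> R by rewrite sqrtr_eq0 -ltNge.
split=> [c _ /matrixP cv q|p q pq].
  move: (cv q 0); rewrite summxE mxE (bigD1 q) //= !mxE !eqxx mulr1.
  rewrite big1 ?addr0 => [/eqP|r rq]; last first.
    by rewrite !mxE eq_sym (negbTE rq) !mulr0.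
  by rewrite mulf_eq0 invr_eq0 (negbTE s2) orbF => /eqP.
rewrite /edist /standard_simplex -scalerBr dotvZl dotvZr mulrA -expr2.
rewrite exprVn sqr_sqrtr // dotvDr dotvNr !dotv_delta !mxE !eqxx !andbT.
rewrite (negbTE pq) eq_sym (negbTE pq) /= subr0 sub0r opprK.
by rewrite mulVf ?pnatr_eq0 // sqrtr1.
Qed.

Lemma standard_configurationE (R : realType) (d : nat) (t1 t2 : R)
    (x := @standard_configuration R d t1 t2) (v := simplex_part x) :
  (1 < d)%N -> t1 != t2 ->
  [/\ symmetric_configuration x, unit_regular_simplex v,
      const_mx 1 != 0 :> 'cV[R]_d,
      forall p q, dotv (const_mx 1) (v p - v q) = 0
    & x (body 1) = barycenter v + t1 *: const_mx 1 /\
      x (body 2) = barycenter v + t2 *: const_mx 1].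
Proof.
move=> d1 t12.
have vE q : v q = standard_simplex R q.
  by rewrite /v /simplex_part /x /standard_configuration (unsplitK (inr q)).
have bE : barycenter v = barycenter (@standard_simplex R d).
  by rewrite /barycenter (eq_bigr _ (fun q _ => vE q)).
have hv : unit_regular_simplex v.
  have [h1 h2] := standard_simplex_regular R d.
  split=> [c c0 cv|p q pq]; last by rewrite !vE h2.
  apply: h1 => //; rewrite -[RHS]cv; apply: eq_bigr => q _; by rewrite vE.
have u0 : const_mx 1 != 0 :> 'cV[R]_d.
  apply/eqP => /matrixP/(_ (Ordinal d1) 0) /eqP.
  by rewrite !mxE oner_eq0.
have huv p q : dotv (const_mx 1) (v p - v q) = 0.
  by rewrite dotvDr dotvNr !vE !dotvZr !dotv_delta !mxE subrr.
have x1 : x (body 1) = barycenter v + t1 *: const_mx 1.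
  rewrite bE body1E /x /standard_configuration.
  by rewrite (unsplitK (inl (ord0 : 'I_2))).
have x2 : x (body 2) = barycenter v + t2 *: const_mx 1.
  rewrite bE body2E /x /standard_configuration.
  by rewrite (unsplitK (inl (ord_max : 'I_2))).
split=> //; split=> //.
  by exists (const_mx 1) => //; exists t1, t2.
rewrite x1 x2 => /addrI/eqP; rewrite -subr_eq0 -scalerBl scaler_eq0 subr_eq0.
by rewrite (negbTE t12) (negbTE u0).
Qed.

(** The exponent [a = 1/2] reduces the nonvanishing to a comparison of plain distances. *)
Lemma Rdist_half (R : realType) (d : nat) (x : 'I_d.+2 -> 'cV[R]_d) i j :
  Rdist 2^-1 x i j = edist (x i) (x j).
Proof. by rewrite /Rdist divff ?pnatr_eq0 // powRr1 // sqrtr_ge0. Qed.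

Lemma laura_andoyer_triangle_eq0 (R : realType) (d : nat) (a : R)
    (m : 'I_d.+2 -> R) (x : 'I_d.+2 -> 'cV[R]_d) (i j l1 l2 : 'I_d.+2) :
    triangle x l1 = 0 -> triangle x l2 != 0 -> m l1 != 0 ->
    laura_andoyer a m x i j l1 l2 = 0 ->
  Rdist a x i l1 = Rdist a x j l1.
Proof.
rewrite /laura_andoyer => ->.
move: (triangle x l2) (Rdist a x i l1) => D r D0 m0.
move: (Rdist a x j l1) (Rdist a x i l2 - Rdist a x j l2) => r1 r2.
rewrite mulr0 subr0 => /eqP; rewrite !mulf_eq0 (negbTE D0) (negbTE m0) orbF.
by rewrite subr_eq0 => /eqP.
Qed.

(** If [t1 = 0], the relation between the axial weights becomes [c_2 t_2 = 0] with [t_2] nonzero, so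
    the minor omitting [body 2] vanishes. The vertex minors are then proportional to the one
    omitting [body 1], whose vanishing would force [t2 = 0] as well. The case [t2 = 0] is
    symmetric. *)
Lemma triangle_central_pole (R : realType) (d : nat) (x : 'I_d.+2 -> 'cV[R]_d)
    (u : 'cV[R]_d) (t1 t2 : R) (q : 'I_d) :
    let v := simplex_part x in
    affinely_independent v -> u != 0 -> (forall p q, dotv u (v p - v q) = 0) ->
    x (body 1) = barycenter v + t1 *: u -> x (body 2) = barycenter v + t2 *: u ->
    t1 != t2 ->
  (t1 = 0 -> triangle x (body 2) = 0 /\ triangle x (rshift 2 q) != 0) /\
  (t2 = 0 -> triangle x (body 1) = 0 /\ triangle x (rshift 2 q) != 0).
Proof.
move=> v hv u0 huv x1 x2 t12.
have [s0 sx] := triangle_dependency x.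
have [ct cE] := symmetric_dependency hv u0 huv x1 x2 s0 sx.
have [n1 n2] := triangle_pole_eq0 hv u0 huv x1 x2.
have dV : d%:R^-1 != 0 :> R.
  by rewrite invr_eq0 pnatr_eq0 -lt0n (leq_trans _ (ltn_ord q)).
rewrite cE; move: (triangle x (body 1)) (triangle x (body 2)) ct n1 n2 => D1 D2.
move=> /eqP ct n1 n2; split=> t0; move: ct t12; rewrite t0 mulr0.
  rewrite add0r mulf_eq0 => /orP[/eqP D20|/eqP-> /eqP//] t20; split=> //.
  rewrite mulf_neq0 // oppr_eq0 D20 addr0.
  by apply: contraNneq t20 => /n1 ->.
rewrite addr0 mulf_eq0 => /orP[/eqP D10|/eqP-> /eqP//] t10; split=> //.
rewrite mulf_neq0 // oppr_eq0 D10 add0r.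
by apply: contraNneq t10 => /n2 ->.
Qed.

Lemma laura_andoyer_pole_nontrivial (R : realType) (d : nat) (p q : 'I_d)
    (hd : (1 < d)%N) :
  ~ for_all_symmetric (fun (a s k : R) x =>
      laura_andoyer a (masses s k) x
        (body 1) (rshift 2 p) (body 2) (rshift 2 q) = 0) /\
  ~ for_all_symmetric (fun (a s k : R) x =>
      laura_andoyer a (masses s k) x
        (body 2) (rshift 2 p) (body 1) (rshift 2 q) = 0).
Proof.
have n10 : 1 <> 0 :> R by apply/eqP; rewrite oner_eq0.
split=> H.
  (* With [body 1] at the barycenter and unit masses, the equation would make [body 2] equally far
     from the barycenter and from a vertex. *)
  have t01 : 0 != 1 :> R by rewrite eq_sym oner_eq0.
  have [hx hv u0 huv [x1 x2]] := standard_configurationE hd t01.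
  have [/(_ erefl)[D2 Dq] _] := triangle_central_pole q hv.1 u0 huv x1 x2 t01.
  have m0 : masses 1 1 (body 2 : 'I_d.+2) != 0 :> R by rewrite masses2 oner_eq0.
  have := laura_andoyer_triangle_eq0 D2 Dq m0 (H 2^-1 1 1 _ n10 n10 hx).
  rewrite [RHS]RdistC !Rdist_half => /eqP; apply/negP.
  move: x1; rewrite scale0r addr0 x2 => ->.
  by rewrite lt_eqF // edist_pole_simplex.
(* The axial positions are exchanged: [body 2] is now at the barycenter. *)
have t10 : 1 != 0 :> R by rewrite oner_eq0.
have [hx hv u0 huv [x1 x2]] := standard_configurationE hd t10.
have [_ /(_ erefl)[D1 Dq]] := triangle_central_pole q hv.1 u0 huv x1 x2 t10.
have m0 : masses 1 1 (body 1 : 'I_d.+2) != 0 :> R by rewrite masses1 oner_eq0.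
have := laura_andoyer_triangle_eq0 D1 Dq m0 (H 2^-1 1 1 _ n10 n10 hx).
rewrite [RHS]RdistC !Rdist_half => /eqP; apply/negP.
move: x2; rewrite scale0r addr0 x1 => ->.
by rewrite lt_eqF // edist_pole_simplex.
Qed.

Theorem proposition7 (R : realType) (d : nat) (hd : (2 <= d)%N) :
  let L a s k (x : 'I_d.+2 -> 'cV[R]_d) := laura_andoyer a (masses s k) x in
  let L1324 a s k x := L a s k x (body 1) (body 3) (body 2) (body 4) in
  let L2314 a s k x := L a s k x (body 2) (body 3) (body 1) (body 4) in
  [/\ (forall i j l1 l2 : 'I_d.+2,
         uniq [:: i; j; l1; l2] -> (i < j)%N -> (l1 < l2)%N ->
         [\/ for_all_symmetric (fun a s k x => L a s k x i j l1 l2 = 0),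
             for_all_symmetric
               (fun a s k x => L a s k x i j l1 l2 = L1324 a s k x)
           | for_all_symmetric
               (fun a s k x => L a s k x i j l1 l2 = L2314 a s k x)]),
      ~ for_all_symmetric (fun a s k x => L1324 a s k x = 0),
      ~ for_all_symmetric (fun a s k x => L2314 a s k x = 0),
      for_all_symmetric (fun a s k x =>
        let m : 'I_d.+2 -> R := masses s k in
        let R_ p q := Rdist a x (body p) (body q) in
        let D_ p := triangle x (body p) in
        L1324 a s k x =
          m (body 2) * (R_ 1%N 2%N - R_ 2%N 3%N) * D_ 4%N
          - m (body 4) * (R_ 1%N 4%N - R_ 3%N 4%N) * D_ 2%N)
    & for_all_symmetric (fun a s k x =>
        let m : 'I_d.+2 -> R := masses s k in
        let R_ p q := Rdist a x (body p) (body q) in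
        let D_ p := triangle x (body p) in
        L2314 a s k x =
          m (body 1) * (R_ 1%N 2%N - R_ 1%N 3%N) * D_ 4%N
          - m (body 4) * (R_ 2%N 4%N - R_ 3%N 4%N) * D_ 1%N)].
Proof.
move=> L L1324 L2314.
(* The bound on [d] provides two distinct vertices, of indices 0 and 1 in the simplex. *)
have b3 : body 3 = rshift 2 (Ordinal (ltnW hd)) :> 'I_d.+2 := body_rshift (ltnW hd).
have b4 : body 4 = rshift 2 (Ordinal hd) :> 'I_d.+2 := body_rshift hd.
split.
- move=> i j l1 l2 hu ij ll; rewrite /L1324 /L2314 b3 b4.
  exact: laura_andoyer_trichotomy.
- rewrite /L1324 b3 b4.
  by have [] :=
    @laura_andoyer_pole_nontrivial R d (Ordinal (ltnW hd)) (Ordinal hd) hd.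
- rewrite /L2314 b3 b4.
  by have [] :=
    @laura_andoyer_pole_nontrivial R d (Ordinal (ltnW hd)) (Ordinal hd) hd.
(* The displayed formulas differ from the definition only by the symmetry of [Rdist]. *)
- move=> a s k x _ _ _ /=.
  by rewrite /L1324 /L /laura_andoyer (RdistC _ _ (body 3) (body 2)).
move=> a s k x _ _ _ /=.
rewrite /L2314 /L /laura_andoyer (RdistC _ _ (body 3) (body 1)).
by rewrite (RdistC _ _ (body 2) (body 1)).
Qed.
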